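(* Let $q'$ be a prime power with $q=(q')^{3}\geq 64$. Then for every codimension $r=3t+1\geq 7$ there exists a linear $[n_r,n_r-r]_q$ code $\mathcal{C}_r$ with covering radius $3$ and length $$n_r=\left(4+\frac{4}{\sqrt[3]{q}}\right)q^{\frac{r-3}{3}},$$ and the family satisfies $$\liminf_{r\to\infty}\frac{V_q(n_r,3)}{q^{r}}<\frac{32}{3}+\frac{32}{\sqrt[3]{q}}+\frac{32}{\sqrt[3]{q^{2}}}-\frac{64}{3q}.$$
   Context: For a prime power $q$, an $[n,n-r]_q$ code is a linear subspace of $F_q^n$ of dimension $n-r$; it has covering radius $R$ if every column of $F_q^{r}$ is a linear combination of at most $R$ columns of a parity-check matrix, and $R$ is the smallest such integer. $V_q(n,R)=\sum_{i=0}^{R}(q-1)^i\binom{n}{i}$ is the size of a Hamming sphere of radius $R$ in $F_q^n$; $V_q(n,R)/q^r$ is the covering density of an $[n,n-r]_qR$ code. *)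

(* Defs.v *)
From HB Require Import structures.
From mathcomp Require Import all_boot all_order all_algebra.
From mathcomp Require Import all_classical all_reals all_analysis.

Set Implicit Arguments.
Unset Strict Implicit.
Unset Printing Implicit Defensive.

Import Order.TTheory GRing.Theory Num.Theory.

Local Open Scope ring_scope.

Definition prime_power (q : nat) : Prop :=
  exists p k : nat, [/\ prime p, (0 < k)%N & q = (p ^ k)%N].

(* Written additively so that truncated subtraction plays no role:
   r <= n and \dim C = n - r. *)
Definition is_code (F : finFieldType) (n r : nat) (C : {vspace 'rV[F]_n}) :
  Prop := (\dim C + r)%N = n.

Definition parity_check_matrix (F : finFieldType) (n r : nat)
    (C : {vspace 'rV[F]_n}) (H : 'M[F]_(r, n)) : Prop :=
  \rank H = r /\ forall x : 'rV[F]_n, (x \in C) = (H *m x^T == 0).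

Definition columns_cover (F : finFieldType) (n r : nat) (H : 'M[F]_(r, n))
    (R : nat) : Prop :=
  forall s : 'cV[F]_r, exists (J : {set 'I_n}) (c : 'I_n -> F),
    (#|J| <= R)%N /\ s = \sum_(j in J) c j *: col j H.

(* Two parity-check matrices of C differ by an invertible left factor, so
   columns_cover does not depend on the choice of H; the existential rules out
   the vacuous case where C has no r-row parity-check matrix. *)
Definition covering_radius (F : finFieldType) (n r : nat)
    (C : {vspace 'rV[F]_n}) (R : nat) : Prop :=
  exists H : 'M[F]_(r, n),
    [/\ parity_check_matrix C H, columns_cover H R &
        forall R' : nat, columns_cover H R' -> (R <= R')%N].

Definition sphere_size (q n R : nat) : nat :=
  (\sum_(0 <= i < R.+1) (q - 1) ^ i * 'C(n, i))%N.

Definition covering_density (K : realType) (q n r R : nat) : K :=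
  (sphere_size q n R)%:R / q%:R ^+ r.

Definition cbrt (K : realType) (x : K) : K := x `^ 3^-1.

(* Main.v *)
(* Write q' = p and let S be the subfield of order p of F.  For s in F^4 the
   S-linear map u |-> u . s from S^4 to F has a kernel, because #|F| = p^3, so
   s lies on a plane u of PG(3, p).  Hence a set of points of PG(3, p) which
   spans every plane of PG(3, p) already has every vector of F^4 in the F-span
   of three of its points.  Four lines that have no common transversal form
   such a set, here the lines {(v, 0)}, {(0, v)}, {(v, v)} and {(v, M v)} with
   M a 2 x 2 matrix over S without eigenvalues in S; this gives 4(p + 1)
   vectors h_i.  A point of a line is a combination of any two others, so
   every s is in fact a combination with nonzero coefficients of exactly three
   h_i.  With distinct b_i in F, the columns (h_i, x, b_i x, b_i^2 x) for x in
   F^m then cover F^(4 + 3m), by solving a 3 x 3 Vandermonde system.  Counting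
   shows that two columns do not suffice, and the density is at most its limit
   (q - 1)^3 (4(p + 1))^3 / (6 q^4) plus a term O(q^(-t)). *)
Require Import Defs.
From HB Require Import structures.
From mathcomp Require Import all_boot all_order all_algebra all_field.
From mathcomp Require Import all_classical all_reals all_analysis.
From mathcomp Require Import ring lra zify.

Set Implicit Arguments.
Unset Strict Implicit.
Unset Printing Implicit Defensive.

Import Order.TTheory GRing.Theory Num.Theory.

Local Open Scope ring_scope.

(** * The subfield of order p *)

Lemma exprB_pchar (A : comNzRingType) (l k : nat) (x y : A) :
  l \in [pchar A] -> (x - y) ^+ (l ^ k) = x ^+ (l ^ k) - y ^+ (l ^ k).
Proof.
move=> ch; apply: (addIr (y ^+ (l ^ k))); rewrite subrK -exprDn_pchar ?subrK //.
by rewrite pnatX (eq_pnat _ (pcharf_eq ch)) pnat_id // (pcharf_prime ch).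
Qed.

(** With [p = l ^ k], the polynomial ['X^p - 'X] divides ['X^(p ^ d) - 'X], which is the product of
    all ['X - x] with [x] in [F]. So it splits into distinct linear factors, and its roots are as
    many as its degree. *)
Lemma card_fixed_Frobenius (F : finFieldType) (l k d : nat) :
  prime l -> (0 < k)%N -> #|F| = ((l ^ k) ^ d)%N ->
  #|[pred x : F | x ^+ (l ^ k) == x]| = (l ^ k)%N.
Proof.
move=> pl k0 cF.
have ch : l \in [pchar F].
  by move: cF; rewrite -expnM => /card_finPcharP; apply.
set p := (l ^ k)%N in cF *.
have p1 : (1 < p)%N by rewrite -(exp1n k) ltn_exp2r // prime_gt1.
have chP : l \in [pchar {poly F}].
  by rewrite inE pl -polyC_natr polyC_eq0 (pcharf0 ch) eqxx.
have dvd e : ('X^p - 'X : {poly F}) %| 'X^(p ^ e) - 'X.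
  elim: e => [|e IHe]; first by rewrite expn0 expr1 subrr dvdp0.
  have -> : 'X^(p ^ e.+1) - 'X = ('X^(p ^ e) - 'X) ^+ p + ('X^p - 'X) :> {poly F}.
    by rewrite exprB_pchar // -exprM -expnSr addrA subrK.
  by rewrite dvdp_add // (dvdp_trans IHe) // dvdp_exp // ltnW.
have sz e : (1 < e)%N -> size ('X^e - 'X : {poly F}) = e.+1.
  by move=> e1; rewrite size_polyDl ?size_polyXn // size_polyN size_polyX.
have := dvd d; rewrite -cF finField_genPoly.
move=> /dvdp_prod_XsubC[m] eqm.
have sz1 := eqp_size eqm; rewrite sz // size_prod_XsubC in sz1.
apply: etrans (esym (succn_inj sz1)); rewrite cardE.
apply/perm_size/uniq_perm; rewrite ?enum_uniq ?mask_uniq ?index_enum_uniq // => x.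
by rewrite mem_enum -root_prod_XsubC -(eqp_root eqm) inE rootE !hornerE subr_eq0.
Qed.

Lemma exists_subfield (F : finFieldType) (p d : nat) :
  prime_power p -> #|F| = (p ^ d)%N -> exists S : divringClosed F, #|S| = p.
Proof.
move=> [l [k [pl k0 ->]]] cF.
have ch : l \in [pchar F].
  by move: cF; rewrite -expnM => /card_finPcharP; apply.
pose P := [pred x : F | x ^+ (l ^ k) == x].
have Pc : divring_closed P.
  split=> [|x y|x y]; rewrite !inE ?expr1n // => /eqP ex /eqP ey.
  - by rewrite exprB_pchar // ex ey.
  - by rewrite expr_div_n ex ey.
pose S := HB.pack_for (divringClosed F) (P : {pred F}) (GRing.isDivringClosed.Build F P Pc).
by exists S; apply: card_fixed_Frobenius cF.
Qed.

(** The map [x ^+ 2 - x] sends both 0 and 1 to 0. It is not injective on the finite set [S], hence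
    not onto [S], and any missed value serves as [m]; this works in every characteristic. *)
Lemma exists_irreducible_quadratic (F : finFieldType) (S : divringClosed F) :
  exists2 m, m \in S & forall x, x \in S -> x ^+ 2 - x != m.
Proof.
pose A := [set x in S]; pose f (x : F) := x ^+ 2 - x.
have fA : f @: A \subset A.
  apply/fintype.subsetP => _ /imsetP[x xS ->]; move: xS; rewrite !inE => xS.
  by rewrite rpredB ?rpredX.
have fAp : f @: A \proper A.
  rewrite finset.properEneq fA andbT; apply/eqP => e.
  have /finset.imset_injP inj : #|f @: A| == #|A| by rewrite e.
  have := inj 0 1; rewrite /f !inE rpred0 rpred1 expr0n expr1n !subrr => /(_ isT isT erefl)/eqP.
  by rewrite eq_sym oner_eq0.
have /fintype.properP[_ [m mA mf]] := fAp; exists m; first by rewrite inE in mA.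
by move=> x xS; apply: contra mf => /eqP <-; apply: (finset.imset_f f); rewrite inE.
Qed.

(** * Four lines of PG(3, p) *)

(* A combination of three h's with distinct indices and coefficients in P. *)
Definition comb3 (F : fieldType) (V : lmodType F) (I : eqType) (h : I -> V) (P : pred F) (s : V) :=
  exists (i j k : I) (x y z : F),
    [/\ [&& i != j, i != k & j != k], [&& P x, P y & P z] &
        s = x *: h i + y *: h j + z *: h k].

(* The hypothesis rewrites a missing term as a relation among other h's, which
   raises the number of indices used to exactly three. *)
Lemma comb3_neq0 (F : fieldType) (V : lmodType F) (I : eqType) (h : I -> V) (s : V) :
    (forall i l : I, exists (j k : I) (a b : F),
      [/\ j != k, [&& j != i, j != l, k != i & k != l], a != 0, b != 0 &
          h i = a *: h j + b *: h k]) ->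
  comb3 h predT s -> comb3 h (fun x => x != 0) s.
Proof.
move=> split.
have E2 (i l : I) (x y : F) : i != l -> x != 0 -> y != 0 ->
    comb3 h (fun x => x != 0) (x *: h i + y *: h l).
  move=> il x0 y0; have [j [k [a [b [jk /and4P[_ jl _ kl] a0 b0 ->]]]]] := split i l.
  exists j, k, l, (x * a), (x * b), y; rewrite jk jl kl !mulf_neq0 // y0.
  by rewrite scalerDr !scalerA.
have E1 (i : I) (x : F) : comb3 h (fun x => x != 0) (x *: h i).
  have [j [k [a [b [jk /and4P[ji _ ki _] a0 b0 e]]]]] := split i i.
  (* For [x != 0], splitting [h i] gives two terms, which [E2] makes three. The zero vector is the
     splitting relation itself, with all three terms on one side. *)
  have [->|x0] := eqVneq x 0; last first.
    by rewrite e scalerDr !scalerA; apply: E2 => //; rewrite mulf_neq0.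
  exists i, j, k, (-1), a, b; rewrite eq_sym ji eq_sym ki jk oppr_eq0 oner_eq0 a0 b0.
  by split=> //; rewrite scale0r scaleN1r -addrA -e addNr.
move=> [i [j [k [x [y [z [/and3P[ij ik jk] _ ->]]]]]]].
have [->|x0] := eqVneq x 0; have [->|y0] := eqVneq y 0; have [->|z0] := eqVneq z 0;
  rewrite ?scale0r ?add0r ?addr0; try exact: E2; try exact: E1.
- by rewrite -(scale0r (h i)); apply: E1.
- by exists i, j, k, x, y, z; rewrite ij ik jk x0 y0 z0.
Qed.

Lemma ord2_ind (P : 'I_2 -> Prop) : P 0 -> P 1 -> forall i, P i.
Proof. by move=> P0 P1 [[|[|//]] i2]; [move: P0|move: P1]; congr P; apply: val_inj. Qed.

Section FourLines.
Variables (F : finFieldType) (S : divringClosed F).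

Let K := {x : F | x \in S}.
Let K0 : K := exist (fun x => x \in S) 0 (rpred0 S).

(* The points of PG(1, K): [Some k] is (1, k) and [None] is (0, 1). *)
Definition pt (t : option K) : 'cV[F]_2 :=
  \col_i (if t is Some k then (if i == 0 then 1 else sval k) else (i != 0)%:R).

Definition det2 (u v : 'cV[F]_2) := u 0 0 * v 1 0 - u 1 0 * v 0 0.

Lemma det2_pt_neq0 (t t' : option K) : t != t' -> det2 (pt t) (pt t') != 0.
Proof.
case: t t' => [k|] [k'|] //= kk'; rewrite /det2 !mxE /= ?mul0r ?mul1r ?mulr0 ?mulr1 ?subr0
  ?sub0r ?oppr_eq0 ?oner_eq0 //.
by rewrite subr_eq0 eq_sym; apply: contra kk' => /eqP/val_inj->.
Qed.

Lemma cramer2 (u v w : 'cV[F]_2) : det2 v w != 0 ->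
  u = (det2 u w / det2 v w) *: v + (det2 v u / det2 v w) *: w.
Proof. by rewrite /det2 => d; apply/colP; apply: ord2_ind; rewrite !mxE; field. Qed.

(** Cramer's rule: the coefficients are quotients of determinants of pairs of distinct points, hence
    nonzero. *)
Lemma pt_comb (t t1 t2 : option K) : t1 != t -> t2 != t -> t1 != t2 ->
  exists a b, [/\ a != 0, b != 0 & pt t = a *: pt t1 + b *: pt t2].
Proof.
move=> t1t t2t t12.
have d12 := det2_pt_neq0 t12.
have d02 : det2 (pt t) (pt t2) != 0 by rewrite det2_pt_neq0 // eq_sym.
have d10 := det2_pt_neq0 t1t.
exists (det2 (pt t) (pt t2) / det2 (pt t1) (pt t2)), (det2 (pt t1) (pt t) / det2 (pt t1) (pt t2)).
split; try by rewrite mulf_neq0 ?invr_eq0.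
exact: cramer2.
Qed.

Definition dot (a b : F) (v : 'cV[F]_2) := a * v 0 0 + b * v 1 0.

Lemma dotB (a b x : F) (u v : 'cV[F]_2) : dot a b (u - x *: v) = dot a b u - x * dot a b v.
Proof. by rewrite /dot !mxE; ring. Qed.

Lemma exists_orth_pt (a b : F) : a \in S -> b \in S -> exists t, dot a b (pt t) = 0.
Proof.
move=> aS bS; have [->|b0] := eqVneq b 0.
  by exists None; rewrite /dot !mxE /= mulr0 mul0r addr0.
have cS : - a / b \in S by rewrite rpred_div // rpredN.
by exists (Some (exist (fun x => x \in S) _ cS)); rewrite /dot !mxE /=; field.
Qed.

(** The solutions of a nonzero linear equation in [F ^ 2] form a line, spanned here by [pt t]. The
    entries of [v] range over all of [F]. *)
Lemma orth_pt (a b : F) (t : option K) (v : 'cV[F]_2) :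
  (a != 0) || (b != 0) -> dot a b (pt t) = 0 -> dot a b v = 0 ->
  exists x, v = x *: pt t.
Proof.
rewrite /dot !mxE; case: t => [k|] /= ab0.
  rewrite mulr1 => e; have {}e : a = - b * sval k by rewrite mulNr; apply/eqP; rewrite -addr_eq0 e.
  have b0 : b != 0 by move: ab0; rewrite e; case: (eqVneq b 0) => // ->; rewrite oppr0 mul0r eqxx.
  move=> ev; exists (v 0 0); apply/colP; apply: ord2_ind; rewrite !mxE /= ?mulr1 //.
  by apply: (mulfI b0); apply: (addrI (a * v 0 0)); rewrite ev e; ring.
rewrite mulr0 add0r mulr1 => b0; move: ab0; rewrite b0 eqxx orbF mul0r addr0 => a0 /eqP.
rewrite mulf_eq0 (negPf a0) => /eqP v0.
by exists (v 1 0); apply/colP; apply: ord2_ind; rewrite !mxE /= ?mulr1 ?mulr0.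
Qed.

Variable m : F.

(* The matrix [[1, -1], [-m, 0]], with characteristic polynomial X^2 - X - m. *)
Definition mulM (v : 'cV[F]_2) : 'cV[F]_2 :=
  \col_i (if i == 0 then v 0 0 - v 1 0 else - m * v 0 0).

(** The first boolean separates the two coordinate lines from the two whose points have [v] as upper
    half; [third_point] chooses among the latter. *)
Definition line_pt (l : bool * bool) (v : 'cV[F]_2) : 'cV[F]_(2 + 2) :=
  match l with
  | (false, false) => col_mx v 0
  | (false, true) => col_mx 0 v
  | (true, false) => col_mx v v
  | (true, true) => col_mx v (mulM v)
  end.

Definition four_lines (i : (bool * bool) * option K) := line_pt i.1 (pt i.2).

Lemma line_ptD (l : bool * bool) (a b : F) (u v : 'cV[F]_2) :
  line_pt l (a *: u + b *: v) = a *: line_pt l u + b *: line_pt l v.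
Proof.
have MD : mulM (a *: u + b *: v) = a *: mulM u + b *: mulM v.
  by apply/colP; apply: ord2_ind; rewrite !mxE /=; ring.
by case: l => [] [] [] /=; rewrite !scale_col_mx add_col_mx ?MD ?scaler0 ?addr0.
Qed.

(** At [(1, k)] the determinant is the characteristic polynomial of M at [k], and at [(0, 1)] it is
    1. So no point over [S] is an eigenvector of M. *)
Lemma det2_mulM (t : option K) :
  (forall x, x \in S -> x ^+ 2 - x != m) -> det2 (pt t) (mulM (pt t)) != 0.
Proof.
move=> m_irr; rewrite /det2 !mxE; case: t => [k|] /=; last first.
  by rewrite mul0r !sub0r mul1r opprK oner_eq0.
have -> : 1 * (- m * 1) - sval k * (1 - sval k) = sval k ^+ 2 - sval k - m by ring.
by rewrite subr_eq0 m_irr // (valP k).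
Qed.

(* If both points cut out by the plane on the last two lines were orthogonal to
   (a, b), they would come from one vector v, with v and M v both orthogonal to
   (c, d): v would be an eigenvector of M. *)
Lemma third_point (a b c d : F) :
  m \in S -> (forall x, x \in S -> x ^+ 2 - x != m) ->
  a \in S -> b \in S -> c \in S -> d \in S -> (a != 0) || (b != 0) -> (c != 0) || (d != 0) ->
  exists l t, let w := line_pt (true, l) (pt t) in
    [/\ usubmx w = pt t, dot a b (pt t) + dot c d (dsubmx w) = 0 & dot a b (pt t) != 0].
Proof.
move=> mS m_irr aS bS cS dS ab cd.
(* [t1] and [t2] are the points where the plane meets the lines {(v, v)} and {(v, M v)}:
   substituting these into the equation of the plane gives the two linear forms in v. *)
have [t1 e1] : exists t, dot (a + c) (b + d) (pt t) = 0 by apply: exists_orth_pt; rewrite rpredD.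
have [t2 e2] : exists t, dot (a + c - m * d) (b - c) (pt t) = 0.
  by apply: exists_orth_pt; rewrite ?(rpredB, rpredD, rpredM).
have [z1|] := eqVneq (dot a b (pt t1)) 0; last first.
  move=> nz; exists false, t1 => /=; rewrite col_mxKu col_mxKd; split=> //.
  by rewrite -e1 /dot; ring.
have [z2|] := eqVneq (dot a b (pt t2)) 0; last first.
  move=> nz; exists true, t2 => /=; rewrite col_mxKu col_mxKd; split=> //.
  by rewrite -e2 /dot [mulM _ 0 0]mxE [mulM _ 1 0]mxE /=; ring.
have [x ex] := orth_pt ab z1 z2.
have t21 : t2 = t1.
  apply: contraTeq isT => /det2_pt_neq0; rewrite ex /det2 !mxE => /eqP[]; ring.
rewrite {}t21 in e2 z2 => {x ex}.
have w1 : dot c d (pt t1) = 0.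
  transitivity (dot (a + c) (b + d) (pt t1) - dot a b (pt t1)); first by rewrite /dot; ring.
  by rewrite e1 z1 subrr.
have w2 : dot c d (mulM (pt t1)) = 0.
  transitivity (dot (a + c - m * d) (b - c) (pt t1) - dot a b (pt t1)).
    by rewrite /dot [mulM _ 0 0]mxE [mulM _ 1 0]mxE /=; ring.
  by rewrite e2 z1 subrr.
have [x ex] := orth_pt cd w1 w2.
have := det2_mulM t1 m_irr; rewrite ex /det2 !mxE => /eqP[]; ring.
Qed.

(** If [(a, b)] or [(c, d)] vanishes, the plane contains one coordinate line, and two points of it
    together with a point of the other span the plane. Otherwise the plane meets each coordinate
    line in one point, and [third_point] supplies a point of the plane off the line joining these
    two. *)
Lemma four_lines_plane (a b c d : F) (s : 'cV[F]_(2 + 2)) :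
  m \in S -> (forall x, x \in S -> x ^+ 2 - x != m) ->
    a \in S -> b \in S -> c \in S -> d \in S -> [|| a != 0, b != 0, c != 0 | d != 0] ->
    dot a b (usubmx s) + dot c d (dsubmx s) = 0 ->
  comb3 four_lines predT s.
Proof.
move=> mS m_irr aS bS cS dS nz; rewrite -[X in comb3 _ _ X]vsubmxK.
move: (usubmx s) (dsubmx s) => s1 s2 e.
have dec (v : 'cV[F]_2) : v = v 1 0 *: pt None + v 0 0 *: pt (Some K0).
  by apply/colP; apply: ord2_ind; rewrite !mxE /=; ring.
have [ab|ab] := boolP ((a != 0) || (b != 0)); last first.
  have cd : (c != 0) || (d != 0) by move: nz; rewrite orbA (negPf ab).
  move: ab e; rewrite negb_or !negbK => /andP[/eqP-> /eqP->].
  rewrite {1}/dot !mul0r !add0r => e.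
  have [t eo] := exists_orth_pt cS dS; have [z ez] := orth_pt cd eo e.
  exists ((false, false), None), ((false, false), Some K0), ((false, true), t).
  exists (s1 1 0), (s1 0 0), z; split=> //.
  by rewrite /four_lines /= !scale_col_mx !add_col_mx -dec ez !scaler0 ?addr0 ?add0r.
have [cd|cd] := boolP ((c != 0) || (d != 0)); last first.
  move: cd e; rewrite negb_or !negbK => /andP[/eqP-> /eqP->].
  rewrite {2}/dot !mul0r !addr0 => e.
  have [t eo] := exists_orth_pt aS bS; have [z ez] := orth_pt ab eo e.
  exists ((false, true), None), ((false, true), Some K0), ((false, false), t).
  exists (s2 1 0), (s2 0 0), z; split=> //.
  by rewrite /four_lines /= !scale_col_mx !add_col_mx -dec ez !scaler0 ?addr0 ?add0r.
have [l [t []]] := third_point mS m_irr aS bS cS dS ab cd; set w := line_pt _ _ => wu wd w0.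
have [ta ea] := exists_orth_pt aS bS; have [tc ec] := exists_orth_pt cS dS.
(* This [z] makes the upper half of [s - z w] orthogonal to [(a, b)]. As [s] and [w] both lie on the
   plane, the lower half is then orthogonal to [(c, d)]. *)
pose z := dot a b s1 / dot a b (pt t).
have [x ex] : exists x, s1 - z *: pt t = x *: pt ta.
  by apply: orth_pt ab ea _; rewrite dotB divfK ?subrr.
have [y ey] : exists y, s2 - z *: dsubmx w = y *: pt tc.
  apply: orth_pt cd ec _; rewrite dotB.
  have -> : dot c d (dsubmx w) = - dot a b (pt t) by apply/eqP; rewrite -addr_eq0 addrC wd.
  by rewrite mulrN opprK divfK // addrC.
exists ((false, false), ta), ((false, true), tc), ((true, l), t), x, y, z; split=> //.
have -> : four_lines (true, l, t) = col_mx (pt t) (dsubmx w) by rewrite -wu vsubmxK.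
rewrite /four_lines /= !scale_col_mx !add_col_mx !scaler0 addr0 add0r.
by rewrite -ex -ey !subrK.
Qed.

Lemma four_lines_saturating (s : 'cV[F]_(2 + 2)) :
  m \in S -> (forall x, x \in S -> x ^+ 2 - x != m) ->
  (#|F| < #|S| ^ 4)%N -> comb3 four_lines predT s.
Proof.
move=> mS m_irr ltF; pose K4 := (K * K * (K * K))%type.
pose f (u : K4) := dot (sval u.1.1) (sval u.1.2) (usubmx s)
  + dot (sval u.2.1) (sval u.2.2) (dsubmx s).
(* Pigeonhole: the difference of two colliding quadruples gives the coordinates of a plane through
   [s]. *)
have /injectivePn[u [v uv fuv]] : ~~ injectiveb f.
  apply: contraL ltF => /injectiveP/leq_card; rewrite -leqNgt; apply: leq_trans.
  by rewrite !card_prod !card_sig !expnS expn0 muln1 !mulnA.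
have vS (k : K) : sval k \in S := valP k.
apply: (@four_lines_plane (sval u.1.1 - sval v.1.1) (sval u.1.2 - sval v.1.2)
   (sval u.2.1 - sval v.2.1) (sval u.2.2 - sval v.2.2)); rewrite ?rpredB //.
- apply: contraNT uv; rewrite !negb_or !negbK !subr_eq0 => /and4P[].
  move: u v {fuv} => [[? ?] [? ?]] [[? ?] [? ?]] /= /eqP/val_inj-> /eqP/val_inj-> /eqP/val_inj->.
  by move=> /eqP/val_inj->.
- by apply: etrans (_ : f u - f v = 0); [rewrite /f /dot; ring | rewrite fuv subrr].
Qed.

(** Both new points are taken on the line of [i], which has [#|S| + 1] points. Avoiding the
    parameters of [i] and [l] keeps them apart from [l] whichever line [l] is on. *)
Lemma four_lines_split (i l : (bool * bool) * option K) : (3 < #|S|)%N ->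
  exists j k a b, [/\ j != k, [&& j != i, j != l, k != i & k != l], a != 0, b != 0 &
          four_lines i = a *: four_lines j + b *: four_lines k].
Proof.
move=> S3; case: i l => li ti [ll tl].
have /card_gt1P[t1 [t2 []]] : (1 < #|~: [set ti; tl]|)%N.
  have := cardsC [set ti; tl]; rewrite card_option card_sig => e.
  have : (#|[set ti; tl]| <= 2)%N by rewrite cards2; case: eqP.
  by move: e S3; rewrite -[#|[pred x | _]|]/#|S|; lia.
rewrite !inE !negb_or => /andP[t1i t1l] /andP[t2i t2l] t12.
have [a [b [a0 b0 e]]] := pt_comb t1i t2i t12.
exists (li, t1), (li, t2), a, b; split=> //.
- by apply: contra t12 => /eqP[->].
- by rewrite !xpair_eqE !negb_and t1i t1l t2i t2l !orbT.
- by rewrite /four_lines /= e line_ptD.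
Qed.

End FourLines.

(** * Lengthening and covering radius *)

Lemma vandermonde3_solve (F : fieldType) (m n : nat) (a b c : F) (u0 u1 u2 : 'M[F]_(m, n)) :
    a != b -> a != c -> b != c ->
  exists x y z : 'M[F]_(m, n),
    [/\ u0 = x + y + z, u1 = a *: x + b *: y + c *: z &
        u2 = a ^+ 2 *: x + b ^+ 2 *: y + c ^+ 2 *: z].
Proof.
move=> ab ac bc.
(* Lagrange interpolation: expand [(X - e) * (X - f)] and replace the powers of X by [u0], [u1],
   [u2]. This kills the terms at [e] and [f] and multiplies the one at [d] by
   [(d - e) * (d - f)]. *)
pose lag d e f := ((d - e) * (d - f))^-1 *: (u2 - (e + f) *: u1 + (e * f) *: u0).
exists (lag a b c), (lag b a c), (lag c a b).
split; apply/matrixP => i j; rewrite !mxE; field;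
  by rewrite !subr_eq0 ab ac bc (eq_sym b a) (eq_sym c a) (eq_sym c b) ab ac bc.
Qed.

(** The top block fixes the indices and the coefficients [x], [y], [z]. The Vandermonde solutions
    [a], [b], [c] must then be divided by these, which is why they have to be nonzero. *)
Lemma concat_comb3 (F : fieldType) (I : eqType) (d m : nat) (h : I -> 'cV[F]_d) (beta : I -> F) :
    injective beta -> (forall s, comb3 h (fun x => x != 0) s) ->
  forall s : 'cV[F]_(d + (m + (m + m))), comb3 (fun u : I * 'cV[F]_m =>
    col_mx (h u.1) (col_mx u.2 (col_mx (beta u.1 *: u.2) (beta u.1 ^+ 2 *: u.2)))) predT s.
Proof.
move=> binj hc s; rewrite -[s]vsubmxK -[dsubmx s]vsubmxK -[dsubmx (dsubmx s)]vsubmxK.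
move: (usubmx s) (dsubmx s) => s0 v; move: (usubmx v) (dsubmx v) => u0 {}v.
move: (usubmx v) (dsubmx v) => {v} u1 u2.
have [i [j [k [x [y [z [/and3P[ij ik jk] /and3P[x0 y0 z0] ->]]]]]]] := hc s0.
have [] := @vandermonde3_solve F m 1 (beta i) (beta j) (beta k) u0 u1 u2; rewrite ?(inj_eq binj) //.
move=> a [b [c [-> -> ->]]].
exists (i, x^-1 *: a), (j, y^-1 *: b), (k, z^-1 *: c), x, y, z; split=> //.
  by rewrite !xpair_eqE !negb_and ij ik jk.
have sc (e t : F) (v : 'cV[F]_m) : t != 0 -> t *: (e *: (t^-1 *: v)) = e *: v.
  by move=> t0; rewrite !scalerA mulrAC divff // mul1r.
have sc1 (t : F) (v : 'cV[F]_m) : t != 0 -> t *: (t^-1 *: v) = v.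
  by move=> t0; rewrite scalerA divff // scale1r.
by rewrite !scale_col_mx !add_col_mx /= !sc // !sc1.
Qed.

Lemma columns_cover_row_free (F : finFieldType) (n r R : nat) (H : 'M[F]_(r, n)) :
  columns_cover H R -> row_free H.
Proof.
move=> cov.
have ex (s : 'cV[F]_r) : exists y : 'cV[F]_n, s == H *m y.
  have [J [c [_ ->]]] := cov s; exists (\col_j (if j \in J then c j else 0)).
  apply/eqP/colP => i; rewrite summxE mxE big_mkcond; apply: eq_bigr => j _.
  by rewrite !mxE; case: ifP => _; rewrite ?mulr0 1?mulrC.
pose y s := xchoose (ex s).
apply/row_freeP; exists (\matrix_(i, j) y (col j 1%:M) i 0).
apply/matrixP => i j; have /eqP/colP/(_ i) := xchooseP (ex (col j 1%:M)).
by rewrite !mxE => ->; apply: eq_bigr => k _; rewrite mxE.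
Qed.

Lemma columns_cover_le (F : finFieldType) (n r R R' : nat) (H : 'M[F]_(r, n)) :
  (R <= R')%N -> columns_cover H R -> columns_cover H R'.
Proof.
by move=> RR cov s; have [J [c [cJ ->]]] := cov s; exists J, c; rewrite (leq_trans cJ).
Qed.

(** Each vector comes from two pairs of a column and a coefficient, and there are [n * #|F|] such
    pairs. Smaller sets of columns are padded with zero coefficients. *)
Lemma columns_cover2_card (F : finFieldType) (n r : nat) (H : 'M[F]_(r, n)) : (0 < n)%N ->
  columns_cover H 2 -> (#|F| ^ r <= (n * #|F|) ^ 2)%N.
Proof.
move=> n0 cov; pose T := ('I_n * F)%type.
pose f (u : T * T) : 'cV[F]_r := u.1.2 *: col u.1.1 H + u.2.2 *: col u.2.1 H.
have fsurj s : exists u, f u == s.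
  have [J [c [cJ ->]]] := cov s; rewrite /f.
  move: cJ; rewrite leq_eqVlt => /predU1P[/eqP/cards2P[i [j [ij ->]]]|].
    by exists ((i, c i), (j, c j)); rewrite /= big_setU1 ?inE // big_set1.
  rewrite ltnS leq_eqVlt => /predU1P[/eqP/cards1P[i ->]|].
    by exists ((i, c i), (i, 0)); rewrite /= big_set1 scale0r addr0.
  rewrite ltnS leqn0 cards_eq0 => /eqP->; pose i0 := Ordinal n0.
  by exists ((i0, 0), (i0, 0)); rewrite /= big_set0 !scale0r addr0.
have /leq_card : injective (fun s => xchoose (fsurj s)).
  by move=> s t est; rewrite -(eqP (xchooseP (fsurj s))) est (eqP (xchooseP (fsurj t))).
by rewrite card_mx muln1 !card_prod card_ord expnS expn1.
Qed.

(** The code is the kernel of multiplication by [H^T]. Covering gives [H] full row rank, hence the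
    dimension, and the strict inequality excludes radius at most 2 by counting. *)
Lemma covering_code (F : finFieldType) (T : finType) (n r : nat) (w : T -> 'cV[F]_r) :
    #|T| = n -> (0 < n)%N -> ((n * #|F|) ^ 2 < #|F| ^ r)%N -> (forall s, comb3 w predT s) ->
  exists C : {vspace 'rV[F]_n}, is_code r C /\ covering_radius r C 3.
Proof.
move=> <- n0 lt cov; pose H : 'M[F]_(r, #|T|) := \matrix_(i, j) w (enum_val j) i 0.
have colH t : col (enum_rank t) H = w t by apply/colP => i; rewrite !mxE enum_rankK.
have covH : columns_cover H 3.
  move=> s; have [i [j [k [x [y [z [/and3P[ij ik jk] _ ->]]]]]]] := cov s.
  pose c (l : 'I_#|T|) := if enum_val l == i then x else if enum_val l == j then y else z.
  exists [set enum_rank i; enum_rank j; enum_rank k], c; split.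
    by rewrite (leq_trans (leq_card_setU _ _)) // cards1 addn1 ltnS cards2; case: eqP.
  rewrite -finset.setUA !big_setU1 ?inE ?(inj_eq enum_rank_inj) ?negb_or ?ij ?ik // big_set1 !colH.
  rewrite /c !enum_rankK !eqxx (eq_sym j) (eq_sym k i) (eq_sym k) (negPf ij) (negPf ik) (negPf jk).
  exact: esym (addrA _ _ _).
have rfH := columns_cover_row_free covH.
pose f : 'Hom('rV[F]_#|T|, 'rV[F]_r) := linfun (mulmxr H^T).
exists (lker f); split; last first.
  exists H; split=> //.
    split; first exact/eqP.
    by move=> x; rewrite memv_ker lfunE /= -(inj_eq (@trmx_inj _ _ _)) trmx0 trmx_mul trmxK.
  move=> R' covR'; rewrite ltnNge; apply: contraL lt => R'2; rewrite -leqNgt.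
  exact/columns_cover2_card/(columns_cover_le R'2).
rewrite /is_code; have := limg_ker_dim f fullv.
rewrite capfv (dimvf (matrix _ _ _)) dim_matrix mul1r => e; rewrite -[RHS]e; congr (_ + _)%N.
have -> : (f @: fullv)%VS = fullv.
  apply/eqP; rewrite eqEsubv subvf; apply/subvP => v _.
  have [B HB] := row_freeP rfH.
  have -> : v = f (v *m B^T).
    by rewrite lfunE /= -mulmxA -trmx_mul HB trmx1 mulmx1.
  by rewrite memv_img ?memvf.
by rewrite dimvf dim_matrix mul1r.
Qed.

Lemma exists_covering_code (F : finFieldType) (p r t : nat) :
    prime_power p -> (4 <= p)%N -> #|F| = (p ^ 3)%N -> r = (3 * t + 1)%N -> (7 <= r)%N ->
  exists C : {vspace 'rV[F]_(4 * p.+1 * #|F| ^ t.-1)}, is_code r C /\ covering_radius r C 3.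
Proof.
move=> pp p4 cF rE r7.
have [S cS] := exists_subfield pp cF; have [m mS mirr] := exists_irreducible_quadratic S.
pose I := ((bool * bool) * option {x : F | x \in S})%type.
have cI : #|{: I}| = (4 * p.+1)%N.
  by rewrite !card_prod card_bool card_option card_sig -[#|_|]/#|S| cS.
(* From [4 <= p] one gets [4 * p.+1 <= p ^ 3], so [F] has enough elements for distinct [beta i]. *)
have leI : (#|{: I}| <= #|F|)%N by rewrite cI cF !expnS; nia.
pose beta (i : I) : F := enum_val (widen_ord leI (enum_rank i)).
have binj : injective beta.
  move=> i j /enum_val_inj/(congr1 val) /= e; apply: enum_rank_inj; exact: val_inj.
have cov s : comb3 (@four_lines F S m) (fun x => x != 0) s.
  apply: comb3_neq0; last by apply: four_lines_saturating; rewrite // cS cF ltn_exp2l; lia.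
  by move=> i l; apply: four_lines_split => //; rewrite cS.
have t2 : (2 <= t)%N by lia.
have {rE r7} -> : r = ((2 + 2) + (t.-1 + (t.-1 + t.-1)))%N by lia.
apply: (covering_code _ _ _ (concat_comb3 binj cov)).
- by rewrite card_prod cI card_mx muln1.
- by rewrite !muln_gt0 /= expn_gt0 cF expn_gt0; lia.
have -> : (2 + 2 + (t.-1 + (t.-1 + t.-1)) = t.-1 + 2 * t + 2)%N by lia.
have -> : (4 * p.+1 * #|F| ^ t.-1 * #|F| = 4 * p.+1 * #|F| ^ t)%N.
  by rewrite -mulnA -expnSr prednK //; lia.
rewrite expnMn -expnM [(t * 2)%N]mulnC !expnD mulnAC ltn_pmul2r ?expn_gt0 ?cF ?expn_gt0; last lia.
(* After cancelling [#|F| ^ (2 * t)], the square of [4 * p.+1] is at most [#|F| ^ 2], which is below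
   [#|F| ^ t.+1] because [2 <= t]. *)
have : (4 * p.+1 <= p ^ 3)%N by rewrite !expnS expn0; nia.
rewrite -(leq_exp2r _ _ (isT : 0 < 2)%N) => /leq_ltn_trans; apply.
by rewrite -expnD -!expnM ltn_exp2l; lia.
Qed.

(** * Length and covering density *)

Lemma ffact_le_exp (n k : nat) : (n ^_ k <= n ^ k)%N.
Proof. by elim: k => // k IHk; rewrite ffactnSr expnSr leq_mul // leq_subr. Qed.

(** The factor 6 clears the denominator of ['C(n, 3)]. The terms of index 0, 1 and 2 contribute at
    most 6, 6 and 3 times [(q * n) ^ 2], whence 15. *)
Lemma sphere_size3_le (q n : nat) : (0 < n)%N -> (0 < q)%N ->
  (6 * sphere_size q n 3 <= 15 * (q * n) ^ 2 + (q - 1) ^ 3 * n ^ 3)%N.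
Proof.
move=> n0 q0; rewrite /sphere_size !big_nat_recr //= big_nil bin0 bin1 expn0 expn1.
have h2 : ('C(n, 2) * 2 <= n ^ 2)%N by have := ffact_le_exp n 2; rewrite -bin_ffact.
have h3 : ('C(n, 3) * 6 <= n ^ 3)%N by have := ffact_le_exp n 3; rewrite -bin_ffact.
have l1 : (1 <= q * n)%N by rewrite muln_gt0 q0.
have l2 : (q * n <= (q * n) ^ 2)%N by nia.
have l3 : ((q - 1) ^ 3 * ('C(n, 3) * 6) <= (q - 1) ^ 3 * n ^ 3)%N by rewrite leq_mul2l h3 orbT.
have l4 : ((q - 1) ^ 2 * ('C(n, 2) * 2) <= q ^ 2 * n ^ 2)%N.
  by rewrite leq_mul // leq_exp2r // leq_subr.
rewrite -expnMn in l4.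
have l5 : ((q - 1) * n <= q * n)%N by rewrite leq_mul2r leq_subr orbT.
lia.
Qed.

Lemma limn_einf_le_freq (K : realType) (u : nat -> \bar K) (x : \bar K) :
  (forall n, exists2 k, (n <= k)%N & (u k <= x)%E) -> (limn_einf u <= x)%E.
Proof.
move=> h; rewrite limn_einf_lim; apply: lime_le; first exact: is_cvg_einfs.
apply: nearW => n; have [k nk uk] := h n; apply: le_trans uk.
by apply: ereal_inf_lbound; exists k.
Qed.

Lemma cbrt_natX (K : realType) (p : nat) : cbrt (p%:R ^+ 3 : K) = p%:R.
Proof.
by rewrite /cbrt -powR_mulrn // -powRrM mulfV ?pnatr_eq0 // powRr1.
Qed.

(** Here [x] stands for the cube root of q. With [u = x ^+ 3] and [y = (x + 1) ^+ 3] the claim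
    becomes [(u - 1) ^+ 3 * y < u ^+ 3 * (y - 3)], which follows from [u + 2 < y] and [2 <= u]. *)
Lemma limit_density_lt (K : realFieldType) (x : K) : 4 <= x ->
  (x ^+ 3 - 1) ^+ 3 * (4 * (x + 1)) ^+ 3 / (6 * x ^+ 12) <
  32 / 3 + 32 / x + 32 / x ^+ 2 - 64 / (3 * x ^+ 3).
Proof.
move=> x4; have x0 : 0 < x by lra.
have xn : x != 0 by rewrite gt_eqF.
have -> : 32 / 3 + 32 / x + 32 / x ^+ 2 - 64 / (3 * x ^+ 3) =
   64 * ((x ^+ 3) ^+ 3 * ((x + 1) ^+ 3 - 3)) / (6 * x ^+ 12) by field.
rewrite ltr_pM2r ?invr_gt0 ?mulr_gt0 ?exprn_gt0 //.
rewrite exprMn mulrCA; have -> : 4 ^+ 3 = 64 :> K by ring.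
rewrite ltr_pM2l //.
have hy : x ^+ 3 + 2 < (x + 1) ^+ 3.
  have -> : (x + 1) ^+ 3 = x ^+ 3 + 3 * x ^+ 2 + 3 * x + 1 by ring.
  by have : 0 < x ^+ 2; [rewrite exprn_gt0 | lra].
have hu : 2 <= x ^+ 3.
  have -> : x ^+ 3 = x * x * x by ring.
  nra.
move: (x ^+ 3) ((x + 1) ^+ 3) hy hu => u y hy hu.
rewrite -subr_gt0.
have -> : u ^+ 3 * (y - 3) - (u - 1) ^+ 3 * y =
  3 * u * (u - 1) * (y - (u + 2)) + y + 3 * u * (u - 2) by ring.
have : 0 <= 3 * u * (u - 1) * (y - (u + 2)) by rewrite !mulr_ge0; lra.
have : 0 <= 3 * u * (u - 2) by rewrite !mulr_ge0; lra.
lra.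
Qed.

Lemma covering_density_le (K : realType) (A q t : nat) : (0 < A)%N -> (0 < q)%N -> (0 < t)%N ->
  covering_density K q (A * q ^ t.-1) (3 * t + 1) 3 <=
    5 / 2 * A%:R ^+ 2 / q%:R / q%:R ^+ t + (q%:R - 1) ^+ 3 * A%:R ^+ 3 / (6 * q%:R ^+ 4).
Proof.
move=> A0 q0 t0; have := @sphere_size3_le q (A * q ^ t.-1) _ q0.
rewrite muln_gt0 A0 expn_gt0 q0 => /(_ isT).
rewrite -(ler_nat K) mulnCA -expnS prednK // !(natrD, natrM, natrX) natrB //.
rewrite /covering_density; set s := (sphere_size _ _ _)%:R => hs.
have Q0 : 0 < q%:R :> K by rewrite ltr0n.
have qn : q%:R != 0 :> K by rewrite gt_eqF.
rewrite -(@ler_pM2l _ 6) // mulrA ler_pdivrMr ?exprn_gt0 // (le_trans hs) //.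
have -> : q%:R ^+ (3 * t + 1) = q%:R ^+ 4 * (q%:R ^+ t.-1) ^+ 3 :> K.
  by rewrite -exprM -exprD; congr (_ ^+ _); lia.
have -> : q%:R ^+ t = q%:R * q%:R ^+ t.-1 :> K by rewrite -exprS prednK.
have : q%:R ^+ t.-1 != 0 :> K by rewrite expf_neq0.
move: (q%:R ^+ t.-1) => z zn; rewrite le_eqVlt; apply/orP; left; apply/eqP; field.
by rewrite qn zn.
Qed.

(** The real power is [p] to the integer [3 * t.-1 + 1]; its extra factor [p] turns [4 + 4 / p] into
    [4 * (p + 1)]. *)
Lemma length_formula (K : realType) (p t : nat) : (0 < p)%N -> (0 < t)%N ->
  (4 * p.+1 * (p ^ 3) ^ t.-1)%:R =
  (4 + 4 / cbrt (p ^ 3)%:R) * (p ^ 3)%:R `^ (((3 * t + 1)%:R - 3) / 3) :> K.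
Proof.
move=> p0 t0; rewrite natrX cbrt_natX -powR_mulrn ?ler0n // -powRrM.
have -> : 3%:R * (((3 * t + 1)%:R - 3) / 3) = (3 * t.-1 + 1)%:R :> K.
  rewrite -{1}(prednK t0) !natrD !natrM -natr1.
  by field.
rewrite powR_mulrn // -expnM natrM natrX natrM -natr1 exprD expr1.
by field; rewrite pnatr_eq0 -lt0n.
Qed.

Lemma limn_einf_density_le (K : realType) (A q : nat) (n : nat -> nat) (B : K) :
    (0 < A)%N -> (1 < q)%N -> (forall t, (2 <= t)%N -> n t = (A * q ^ t.-1)%N) ->
    (q%:R - 1) ^+ 3 * A%:R ^+ 3 / (6 * q%:R ^+ 4) < B ->
  (limn_einf (fun t => (covering_density K q (n t) (3 * t + 1) 3)%:E) < B%:E)%E.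
Proof.
move=> A0 q1 nE; set L := _ / _ => LB.
(* Passing to the limit only keeps weak inequalities, so the densities are compared with the
   midpoint of [L] and [B]. *)
apply: (@le_lt_trans _ _ ((L + B) / 2)%:E); last by rewrite lte_fin; lra.
apply: limn_einf_le_freq => m; pose c : K := 5 / 2 * A%:R ^+ 2 / q%:R.
have c0 : 0 <= c by rewrite !mulr_ge0 ?exprn_ge0 ?invr_ge0.
have e0 : 0 < (B - L) / 2 by lra.
(* Since [t < q ^ t], the last entry makes the error term [c / q ^ t] at most [(B - L) / 2]. *)
exists (maxn (maxn m 2) (Num.truncn (c / ((B - L) / 2))).+1).
  by rewrite -maxnA leq_maxl.
set t := maxn _ _; have t2 : (2 <= t)%N by rewrite /t -maxnA maxnCA leq_maxl.
rewrite lee_fin nE // (le_trans (covering_density_le K A0 (ltnW q1) (ltnW t2))) // -/c -/L.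
have ct : c / ((B - L) / 2) < q%:R ^+ t.
  apply: (lt_le_trans (truncnS_gt _)); rewrite -natrX ler_nat.
  by rewrite (leq_trans _ (ltnW (ltn_expl t q1))) // leq_maxr.
have : c / q%:R ^+ t <= (B - L) / 2; last lra.
rewrite ler_pdivrMr ?exprn_gt0 ?ltr0n ?(ltnW q1) // mulrC -ler_pdivrMr //; exact: ltW.
Qed.

Theorem theorem17 (K : realType) (q' q : nat) (F : finFieldType)
    (hq' : prime_power q') (hq : q = (q' ^ 3)%N) (hq64 : (64 <= q)%N)
    (hF : #|F| = q) :
  exists (n : nat -> nat) (C : forall r : nat, {vspace 'rV[F]_(n r)}),
    (forall r t : nat, r = (3 * t + 1)%N -> (7 <= r)%N ->
      [/\ is_code r (C r), covering_radius r (C r) 3 &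
          (n r)%:R = (4 + 4 / cbrt q%:R) * q%:R `^ ((r%:R - 3) / 3) :> K]) /\
    (limn_einf (fun t : nat =>
       (covering_density K q (n (3 * t + 1)%N) (3 * t + 1)%N 3)%:E)
     < (32 / 3 + 32 / cbrt q%:R + 32 / cbrt (q%:R ^+ 2)
        - 64 / (3 * q%:R))%:E)%E.
Proof.
have q'4 : (4 <= q')%N by rewrite -(@leq_exp2r 4 q' 3) // -hq.
have q'0 : (0 < q')%N by apply: leq_trans q'4.
pose P (r : nat) (X : {n : nat & {vspace 'rV[F]_n}}) := forall t, r = (3 * t + 1)%N -> (7 <= r)%N ->
  [/\ is_code r (projT2 X), covering_radius r (projT2 X) 3 &
      projT1 X = (4 * q'.+1 * q ^ t.-1)%N].
have /choice[X PX] : forall r, exists X, P r X.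
  move=> r.
  have [/andP[/eqP rE r7]|no] := boolP ((r == 3 * (r %/ 3) + 1) && (7 <= r))%N; last first.
    (* For the remaining codimensions [P r] holds vacuously, and the zero code of length 0 is a
       default value. *)
    exists (existT (fun n => {vspace 'rV[F]_n}) 0%N 0%VS) => t rE r7.
    by case/negP: no; rewrite r7 andbT; lia.
  have [C [Cc CR]] := exists_covering_code hq' q'4 (etrans hF hq) rE r7.
  exists (existT (fun n => {vspace 'rV[F]_n}) _ C) => t rt _; split=> //=.
  by rewrite hF; congr (_ * _ ^ _)%N; lia.
exists (fun r => projT1 (X r)), (fun r => projT2 (X r)); split.
  move=> r t rE r7; have [Cc CR nE] := PX r t rE r7; split=> //.
  by rewrite nE rE hq length_formula //; lia.
have nE t : (2 <= t)%N -> projT1 (X (3 * t + 1)%N) = (4 * q'.+1 * q ^ t.-1)%N.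
  by move=> t2; have [] := PX _ t erefl _; first lia.
apply: limn_einf_density_le nE _ => //; first lia.
have -> : cbrt (q%:R ^+ 2) = q'%:R ^+ 2 :> K.
  by rewrite hq natrX -exprM mulnC exprM -natrX cbrt_natX natrX.
rewrite hq natrX cbrt_natX natrM -[q'.+1%:R]natr1 -exprM.
by apply: limit_density_lt; rewrite ler_nat.
Qed.
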